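(* Let $(G_n,d_n)_{n\ge 1}$ be a convergent admissible sequence with $d_n\to\infty$. Let $r_n$ $(n=1,2,\dots)$ be integers with $1\le r_n\le \mathrm{v}(G_n)$ such that $r_nd_n/\mathrm{v}(G_n)$ converges to a positive limit $\alpha$. Let $\sigma_n$ and $\sigma_n'$ be the uniform probability measures on the numbers $\lambda/d_n$, where $\lambda$ runs over the $r_n$ largest, respectively the $r_n$ smallest, eigenvalues of $G_n$. Then $\sigma_n$ and $\sigma'_n$ converge weakly to probability measures $\sigma$ supported on $[0,1]$ and $\sigma'$ supported on $[-1,0]$, respectively.
   Context: Graphs are finite, simple and undirected; $\mathrm{v}(F)$ and $\mathrm{c}(F)$ are the numbers of nodes and of connected components of $F$; $\hom(F,G)$ is the number of homomorphisms from $F$ to $G$. An admissible pair is a pair $(G,d)$ where $d\ge 1$ and $G$ is a graph with all degrees $\le d$; an admissible sequence is a sequence of admissible pairs. For a graph $F$ and an admissible pair $(G,d)$, the homomorphism density is $t(F,G,d)=\hom(F,G)/\big(\mathrm{v}(G)^{\mathrm{c}(F)}d^{\,\mathrm{v}(F)-\mathrm{c}(F)}\big)\in[0,1]$. An admissible sequence $(G_n,d_n)$ is convergent if the number sequence $t(F,G_n,d_n)$ converges for every graph $F$. Eigenvalues of a graph are those of its adjacency matrix, counted with multiplicity (all lie in $[-d,d]$ if all degrees are $\le d$); uniform measures are taken with multiplicity. *)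

(* Defs.v *)
From HB Require Import structures.
From mathcomp Require Import all_boot all_order all_algebra.
From mathcomp Require Import all_classical all_reals all_analysis.
From mathcomp Require Import polyrcf.

Set Implicit Arguments.
Unset Strict Implicit.
Unset Printing Implicit Defensive.

Import Order.TTheory GRing.Theory Num.Theory.
Import numFieldNormedType.Exports.

Local Open Scope classical_set_scope.
Local Open Scope ring_scope.

Record sgraph := SGraph {
  node :> finType;
  edge : rel node;
  edge_sym : symmetric edge;
  edge_irrefl : irreflexive edge }.

Definition degree (G : sgraph) (x : G) : nat := #|[set y : G | edge x y]%SET|.

Definition num_nodes (G : sgraph) : nat := #|G|.

Definition num_comps (G : sgraph) : nat := n_comp (@edge G) G.

Definition is_hom (F G : sgraph) (f : {ffun F -> G}) : bool :=
  [forall x, forall y, edge x y ==> edge (f x) (f y)].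

Definition num_homs (F G : sgraph) : nat :=
  #|[set f : {ffun F -> G} | is_hom f]%SET|.

Definition admissible (R : realType) (G : sgraph) (d : R) : Prop :=
  1 <= d /\ forall x : G, (degree x)%:R <= d.

Definition hom_density (R : realType) (F G : sgraph) (d : R) : R :=
  (num_homs F G)%:R /
  ((num_nodes G)%:R ^+ num_comps F * d ^+ (num_nodes F - num_comps F)).

Definition convergent (R : realType) (G : nat -> sgraph) (d : nat -> R) : Prop :=
  forall F : sgraph, cvgn (fun n => hom_density F (G n) (d n)).

Definition adjacency (R : realType) (G : sgraph) : 'M[R]_(num_nodes G) :=
  \matrix_(i, j) (edge (enum_val i) (enum_val j))%:R.

(* The real eigenvalues, each repeated according to its multiplicity as a root
   of the characteristic polynomial. *)
Definition spectrum (R : realType) (n : nat) (A : 'M[R]_n) : seq R :=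
  flatten [seq nseq (mup x (char_poly A)) x | x <- rootsR (char_poly A)].

Lemma mem_rootsR_char_poly (R : realType) (n : nat) (A : 'M[R]_n) (x : R) :
  (x \in rootsR (char_poly A)) = (0 < mup x (char_poly A))%N.
Proof.
have p0 : char_poly A != 0 by rewrite monic_neq0 // char_poly_monic.
by rewrite mup_geq // expr1 dvdp_XsubCl -(roots_on_rootsR p0) in_itv.
Qed.

Lemma count_spectrum (R : realType) (n : nat) (A : 'M[R]_n) (x : R) :
  count_mem x (spectrum A) = mup x (char_poly A).
Proof.
rewrite /spectrum count_flatten -map_comp sumnE big_map.
have [xr|xNr] := boolP (x \in rootsR (char_poly A)); last first.
  rewrite big1_seq; last first.
    move=> y /andP[_ yr] /=; rewrite count_nseq /=.
    by case: eqP yr xNr => [-> ->|_ _ _]; rewrite ?mul0n.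
  by apply/esym/eqP; rewrite -leqn0 leqNgt -mem_rootsR_char_poly.
rewrite (bigD1_seq x) ?uniq_roots //= count_nseq /= eqxx mul1n big1 ?addn0 //.
by move=> y /negbTE yx; rewrite count_nseq /= yx mul0n.
Qed.

Lemma mem_spectrum (R : realType) (n : nat) (A : 'M[R]_n) (x : R) :
  (x \in spectrum A) = eigenvalue A x.
Proof.
have p0 : char_poly A != 0 by rewrite monic_neq0 // char_poly_monic.
rewrite -has_pred1 has_count count_spectrum eigenvalue_root_char.
by rewrite mup_geq // expr1 dvdp_XsubCl.
Qed.

Definition largest_eigenvalues (R : realType) (G : sgraph) (r : nat) : seq R :=
  take r (sort (fun x y : R => y <= x) (spectrum (adjacency R G))).

Definition smallest_eigenvalues (R : realType) (G : sgraph) (r : nat) : seq R :=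
  take r (sort (fun x y : R => x <= y) (spectrum (adjacency R G))).

Definition uniform_measure (R : realType) (s : seq R) :
    {measure set (measurableTypeR R) -> \bar R} :=
  mscale ((size s)%:R^-1)%:nng
    (msum (fun i => \d_(s`_i : measurableTypeR R)) (size s)).

Lemma uniform_measureT (R : realType) (s : seq R) :
  s != [::] -> uniform_measure s setT = 1%E.
Proof.
move=> s0; rewrite /uniform_measure /= /mscale /= /msum.
under eq_bigr do rewrite /= diracT.
rewrite sumEFin sumr_const card_ord -EFinM mulVf // pnatr_eq0.
by rewrite size_eq0.
Qed.

Definition weak_cvg (R : realType)
    (mu : nat -> {measure set (measurableTypeR R) -> \bar R})
    (nu : {measure set (measurableTypeR R) -> \bar R}) : Prop :=
  forall f : R -> R, continuous f -> bounded_fun f ->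
    (\int[mu n]_x (f x)%:E @[n --> \oo] --> \int[nu]_x (f x)%:E)%E.

Definition supported_on (R : realType)
    (mu : {measure set (measurableTypeR R) -> \bar R}) (A : set R) : Prop :=
  mu (~` A) = 0%E.

(* Main.v *)
Require Import Defs.
From mathcomp Require Import all_boot all_order all_algebra.
From mathcomp Require Import all_classical all_reals all_analysis.
From mathcomp Require Import measurable_realfun.
From mathcomp Require Import complex spectral sesquilinear.
From mathcomp Require Import ring lra.

Set Implicit Arguments.
Unset Strict Implicit.
Unset Printing Implicit Defensive.

Import Order.TTheory GRing.Theory Num.Theory.
Import numFieldNormedType.Exports.

Local Open Scope classical_set_scope.
Local Open Scope ring_scope.

(** Write [N] for the number of nodes of [G n], [w = d / N], and [mu] for the
    numbers [lambda / d], which lie in [-1, 1] ([spectrum_adjacency_le]).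

    Homomorphisms of a cycle with [k] nodes are closed walks of length [k], so
    they are counted by the trace of the [k]-th power of the adjacency matrix,
    that is, by the [k]-th power sum of the eigenvalues ([num_homs_cycle],
    [spectrum_symmetric]; the cycle with two nodes is the edge).  After
    normalization, [w] times the [k]-th power sum of the [mu] is the density of
    a cycle ([hom_density_cycle]), hence converges for each [k >= 2].  There is
    no control on the powers 0 and 1: the mass [w * N = d] tends to infinity and
    piles up near 0, and only test polynomials divisible by ['X^2] are usable.

    The uniform measure on the [r] largest [mu] is the law of its own quantile
    function on [0, 1[, which takes the value [s_i], with [s] the decreasing
    sequence of the [mu], on the slice [i / r, (i + 1) / r[.  It is enough to
    show that these quantile functions converge almost everywhere: their limit
    [q] is then measurable, its law is the limit measure, and dominated
    convergence gives weak convergence ([top_average_cvg],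
    [weak_cvg_of_averages]).

    Negative values disappear in the limit: by the convergence of the second
    moment only [O(N / d)] of the [mu] are below a fixed [- e], and
    [r = O(N / d)] is small compared with [N] because [d] tends to infinity
    ([top_quantile_liminf]).  Above 0, if the quantile at [u] oscillated, it
    would be infinitely often at most [a] and infinitely often greater than [b]
    for some rational [0 < a < b]; that means that the proportion (relative to
    [r]) of [mu] above [a] is infinitely often at most [u], and the one above
    [b] infinitely often greater than [u].  A polynomial divisible by ['X^2]
    that jumps from almost 0 to almost 1 between [a] and [b] ([steep_poly])
    has converging averages, whose limit is thus almost [u].  So [u] is
    determined by [a] and [b] ([crossing_le]), and all but countably many [u]
    are points of convergence ([top_quantile_cvg]).

    For the smallest eigenvalues the same argument applies to the numbers
    [- mu], whose power sums are those of the [mu] up to sign. *)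

(** * Eigenvalues of symmetric matrices *)

Lemma char_poly_conj (F : fieldType) n (P A : 'M[F]_n) :
  P \in unitmx -> char_poly (invmx P *m A *m P) = char_poly A.
Proof.
move=> Pu; rewrite /char_poly /char_poly_mx.
set Pc := map_mx polyC P.
have Pcu : Pc \in unitmx by rewrite map_unitmx.
have -> : 'X%:M - map_mx polyC (invmx P *m A *m P) =
   invmx Pc *m ('X%:M - map_mx polyC A) *m Pc.
  rewrite !map_mxM /= map_invmx mulmxBr mulmxBl.
  by rewrite scalar_mxC mulmxKV.
by rewrite !det_mulmx mulrAC -det_mulmx mulVmx // det1 mul1r.
Qed.

Lemma expmx_conj (F : fieldType) n (P A : 'M[F]_n) k :
  P \in unitmx -> (invmx P *m A *m P) ^+ k = invmx P *m (A ^+ k) *m P.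
Proof.
move=> Pu; elim: k => [|k IH]; first by rewrite !expr0 mulmx1 mulVmx.
by rewrite !exprS IH -!mulmxE !mulmxA mulmxK.
Qed.

Lemma exp_diag_mx (F : comNzRingType) n (v : 'rV[F]_n) k :
  diag_mx v ^+ k = diag_mx (map_mx (fun x => x ^+ k) v).
Proof.
elim: k => [|k IH].
  by apply/matrixP => i j; rewrite expr0 !mxE expr0.
rewrite exprS IH -mulmxE mulmx_diag; congr diag_mx.
by apply/rowP => j; rewrite !mxE exprS.
Qed.

Lemma map_mx_exp (F L : pzRingType) (f : {rmorphism F -> L}) n (A : 'M[F]_n) k :
  map_mx f (A ^+ k) = map_mx f A ^+ k.
Proof.
elim: k => [|k IH]; first by rewrite !expr0 map_mx1.
by rewrite !exprS -!mulmxE map_mxM IH.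
Qed.

(** A real symmetric matrix is unitarily diagonalizable over [R[i]], with real
    eigenvalues.  Therefore its characteristic polynomial already splits over
    [R], so that no eigenvalue is missing from [spectrum], and traces of powers
    can be read on the diagonal form. *)
Lemma spectrum_symmetric (R : realType) n (A : 'M[R]_n) : A^T = A ->
  size (spectrum A) = n /\ forall k, \sum_(x <- spectrum A) x ^+ k = \tr (A ^+ k).
Proof.
move=> symA.
pose toC : {rmorphism R -> R[i]} := real_complex R.
pose B := map_mx toC A.
have hermB : B \is hermsymmx.
  apply: realsym_hermsym.
    by apply/is_hermitianmxP; rewrite expr0 scale1r map_mx_id // map_trmx symA.
  by apply/mxOverP => i j; rewrite mxE; apply/complex_realP; exists (A i j).
have /orthomx_spectralP := hermitian_normalmx hermB.
set P := spectralmx B; set D := spectral_diag B => BE.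
have Pu : P \in unitmx := spectral_unit B.
pose v : 'rV[R]_n := \row_j complex.Re (D 0 j).
have DE : D = map_mx toC v.
  apply/rowP => j; rewrite !mxE; apply/esym/RRe_real.
  by have /mxOverP := hermitian_spectral_diag_real hermB.
have toC_inj : injective toC := fmorph_inj toC.
have charA : char_poly A = \prod_(x <- [seq v 0 j | j : 'I_n]) ('X - x%:P).
  apply: (map_poly_inj toC).
  rewrite map_char_poly -/B BE char_poly_conj // char_poly_trig; last first.
    by apply: diag_mx_is_trig.
  rewrite big_map big_enum /= rmorph_prod; apply: eq_bigr => j _.
  by rewrite rmorphB /= map_polyX map_polyC DE !mxE eqxx mulr1n.
have spE : perm_eq (spectrum A) [seq v 0 j | j : 'I_n].
  by apply/allP => x _ /=; rewrite count_spectrum charA mu_prod_XsubC.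
split=> [|k]; first by rewrite (perm_size spE) size_map size_enum_ord.
apply: toC_inj.
rewrite -trace_map_mx map_mx_exp -/B BE expmx_conj // mxtrace_mulC mulmxA.
rewrite mulmxV // mul1mx DE exp_diag_mx mxtrace_diag (perm_big _ spE) big_map.
rewrite big_enum /= rmorph_sum; apply: eq_bigr => j _.
by rewrite !mxE rmorphXn.
Qed.

(** Look at the coordinate of largest modulus of a row eigenvector. *)
Lemma eigenvalue_le_col_sum (R : realFieldType) n (A : 'M[R]_n) (c x : R) :
  (forall j, \sum_i `|A i j| <= c) -> eigenvalue A x -> `|x| <= c.
Proof.
move=> colA /eigenvalueP[v vA v0].
have [i0 vi0] : exists i0, v 0 i0 != 0.
  by apply/existsP; apply: contraNT v0 => /existsPn v0; apply/eqP/rowP => i;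
     rewrite mxE; apply/eqP; rewrite -[_ == _]negbK.
have [j _ jmax] := @arg_maxP _ R _ i0 xpredT (fun j => `|v 0 j|) isT.
have vj_gt0 : 0 < `|v 0 j|.
  by apply: lt_le_trans (jmax i0 isT); rewrite normr_gt0.
rewrite -(ler_pM2r vj_gt0) -normrM.
have <- : (v *m A) 0 j = x * v 0 j by rewrite vA mxE.
rewrite mxE; apply: le_trans (ler_norm_sum _ _ _) _.
apply: (le_trans _ (ler_wpM2r (ltW vj_gt0) (colA j))); rewrite mulr_suml.
by apply: ler_sum => i _; rewrite normrM mulrC ler_wpM2l //; exact: jmax.
Qed.

Lemma spectrum_adjacency_le (R : realType) (G : sgraph) (d x : R) :
  (forall v : G, (degree v)%:R <= d) -> x \in spectrum (adjacency R G) ->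
  `|x| <= d.
Proof.
move=> degG; rewrite mem_spectrum; apply: eigenvalue_le_col_sum => j.
apply: le_trans (degG (enum_val j)).
rewrite /degree -sum1dep_card natr_sum [leRHS]big_mkcond /=.
rewrite [leRHS](reindex (enum_val : 'I_(num_nodes G) -> G)) /=; last first.
  by apply: onW_bij; exact: enum_val_bij.
apply: ler_sum => i _; rewrite mxE normr_nat edge_sym.
by case: (edge _ _).
Qed.

Lemma adjacency_sym (R : realType) (G : sgraph) :
  (adjacency R G)^T = adjacency R G.
Proof. by apply/matrixP => i j; rewrite !mxE edge_sym. Qed.

(** * Homomorphisms of cycles as closed walks *)

Section CycleGraph.
Context (k : nat).

(** The number of nodes is [k.+2], so that [k = 0] gives the edge: one family of
    graphs then provides all the moments from the second one on. *)
Definition cycle_edge (i j : 'I_k.+2) : bool := (j == ordS i) || (i == ordS j).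

Lemma cycle_edge_sym : symmetric cycle_edge.
Proof. by move=> i j; rewrite /cycle_edge orbC. Qed.

Lemma cycle_edge_irrefl : irreflexive cycle_edge.
Proof.
move=> i; rewrite /cycle_edge orbb; apply/negbTE; rewrite -val_eqE /=.
have [ik|ik] := ltnP i.+1 k.+2; first by rewrite modn_small // neq_ltn ltnSn.
have -> : nat_of_ord i = k.+1.
  by apply/eqP; rewrite eqn_leq -ltnS ltn_ord -ltnS.
by rewrite modnn.
Qed.

Definition cycle_graph : sgraph := SGraph cycle_edge_sym cycle_edge_irrefl.

Lemma num_nodes_cycle : num_nodes cycle_graph = k.+2.
Proof. exact: card_ord. Qed.

Lemma num_comps_cycle : num_comps cycle_graph = 1%N.
Proof.
have conn (i : cycle_graph) : connect (@edge cycle_graph) (ord0 : 'I_k.+2) i.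
  case: i; elim=> [|i IH] ik.
    by rewrite (_ : Ordinal ik = ord0) //; exact: val_inj.
  apply: connect_trans (IH (ltnW ik)) (connect1 _).
  by rewrite /= /cycle_edge -val_eqE /= modn_small // eqxx.
have symc : connect_sym (@edge cycle_graph).
  exact: sym_connect_sym (@edge_sym cycle_graph).
rewrite /num_comps -[RHS](n_comp_connect symc (ord0 : 'I_k.+2)).
by apply: eq_n_comp_r => i; rewrite !inE conn.
Qed.

Lemma is_hom_cycle (G : sgraph) (f : {ffun cycle_graph -> G}) :
  is_hom f = [forall i : 'I_k.+2, edge (f i) (f (ordS i))].
Proof.
apply/forallP/forallP => [homf i|homf x].
  by have /forallP/(_ (ordS i))/implyP := homf i; apply; rewrite /= /cycle_edge eqxx.
apply/forallP => y; apply/implyP => /orP[|] /eqP ->; first exact: homf.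
by rewrite edge_sym homf.
Qed.

End CycleGraph.

Lemma sum_tuple_cons (V : nmodType) (T : finType) k (F : k.+1.-tuple T -> V) :
  \sum_t F t = \sum_x \sum_(t : k.-tuple T) F [tuple of x :: t].
Proof.
rewrite pair_big /=.
rewrite (reindex (fun p : T * k.-tuple T => [tuple of p.1 :: p.2])) //=.
exists (fun t => (thead t, [tuple of behead t])) => [[x t] _|t _] /=.
  by congr pair; exact: val_inj.
by rewrite -tuple_eta.
Qed.

(** The entries of the powers of a 0-1 matrix count walks; [t] is the sequence
    of the intermediate points. *)
Lemma exp_rel_mxE (R : nzRingType) n (e : rel 'I_n) k x y :
  ((\matrix_(i, j) (e i j)%:R : 'M[R]_n) ^+ k.+1) x y =
  \sum_(t : k.-tuple 'I_n) (path e x (rcons t y))%:R.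
Proof.
elim: k x => [|k IH] x.
  rewrite expr1 mxE (big_pred1 [tuple]) /= ?andbT // => t.
  by apply/esym/eqP; exact: tuple0.
rewrite exprS -mulmxE mxE sum_tuple_cons; apply: eq_bigr => z _.
rewrite IH mxE mulr_sumr; apply: eq_bigr => t _ /=.
by rewrite -mulnb natrM.
Qed.

Lemma cycle_mktuple (T : eqType) (e : rel T) k (f : 'I_k.+1 -> T) :
  cycle e [tuple f i | i < k.+1] = [forall i, e (f i) (f (ordS i))].
Proof.
set t := mktuple f.
have tE i : tnth t i = f i by rewrite tnth_mktuple.
have nthE x0 (i : 'I_k.+1) : nth x0 t i = f i by rewrite -tnth_nth tE.
have tcons : t = f ord0 :: behead t :> seq T.
  by rewrite {1}(tuple_eta t) /= /thead tE.
rewrite tcons /=.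
have szb : size (behead t) = k by rewrite size_behead size_tuple.
apply/(pathP (f ord0))/forallP => [H i|H i]; last first.
  rewrite size_rcons szb => ik; rewrite -rcons_cons -tcons.
  rewrite nth_rcons size_tuple ik (nthE _ (Ordinal ik)) nth_rcons szb.
  have [ik'|ik'] := ltnP i k.
    rewrite nth_behead (_ : nth _ t i.+1 = f (ordS (Ordinal ik))) //.
    rewrite -[RHS](nthE (f ord0)); congr (nth _ t _) => /=.
    by rewrite modn_small.
  have ik2 : i = k by apply/eqP; rewrite eqn_leq ik' -ltnS ik.
  rewrite if_same (_ : ord0 = ordS (Ordinal ik)) ?H //.
  by apply: val_inj => /=; rewrite ik2 modnn.
have := H i; rewrite size_rcons szb => /(_ (ltn_ord i)).
rewrite -rcons_cons -tcons nth_rcons size_tuple ltn_ord nthE nth_rcons szb.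
case: (ltnP i k) => ik.
  rewrite nth_behead (_ : nth _ t i.+1 = f (ordS i)) //.
  rewrite -[RHS](nthE (f ord0)); congr (nth _ t _) => /=.
  by rewrite modn_small.
have ik2 : nat_of_ord i = k by apply/eqP; rewrite eqn_leq ik -ltnS ltn_ord.
rewrite if_same (_ : ord0 = ordS i) //.
by apply: val_inj => /=; rewrite ik2 modnn.
Qed.

(** Each closed walk is counted once for its starting point, which is the
    diagonal entry of the power, and its intermediate points. *)
Lemma num_homs_cycle (R : realType) (G : sgraph) k :
  (num_homs (cycle_graph k) G)%:R = \tr (adjacency R G ^+ k.+2).
Proof.
rewrite /num_homs -sum1dep_card natr_sum big_mkcond /= /mxtrace.
set e : rel 'I_(num_nodes G) := fun i j => edge (enum_val i) (enum_val j).
under [RHS]eq_bigr do rewrite exp_rel_mxE.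
rewrite -(sum_tuple_cons (fun t => (cycle e t)%:R)).
rewrite (reindex (fun f : {ffun cycle_graph k -> G} =>
   [tuple enum_rank (f i) | i < k.+2])) /=; last first.
  exists (fun t : k.+2.-tuple _ => [ffun i => enum_val (tnth t i)]) => [f _|t _].
    by apply/ffunP => i; rewrite ffunE tnth_mktuple enum_rankK.
  by apply: eq_from_tnth => i; rewrite tnth_mktuple ffunE enum_valK.
apply: eq_bigr => f _.
rewrite (cycle_mktuple e (fun i : 'I_k.+2 => enum_rank (f i))).
rewrite (is_hom_cycle (f : {ffun cycle_graph k -> G})).
under eq_forallb do rewrite /e !enum_rankK.
by case: [forall _, _].
Qed.

(** * Polynomials that approximate a jump *)

Lemma bernoulli_sub (R : realFieldType) (t : R) K :
  0 <= t <= 1 -> 1 - K%:R * t <= (1 - t) ^+ K.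
Proof.
move=> /andP[t0 t1]; elim: K => [|K IH]; first by rewrite mul0r subr0 expr0.
rewrite exprS; apply: (@le_trans _ _ ((1 - t) * (1 - K%:R * t))).
  have : 0 <= K%:R * t * t by rewrite !mulr_ge0.
  by rewrite -natr1; nra.
by rewrite ler_wpM2l // subr_ge0.
Qed.

(** By induction, from [(1 - t) * (1 + (K + 1) * t) <= 1 + K * t]. *)
Lemma exp_sub_le_inv (R : realFieldType) (t : R) K :
  0 <= t <= 1 -> (1 - t) ^+ K * (1 + K%:R * t) <= 1.
Proof.
move=> /andP[t0 t1]; elim: K => [|K IH]; first by rewrite mul0r addr0 mulr1 expr0.
apply: le_trans IH; rewrite exprSr -mulrA ler_wpM2l ?exprn_ge0 ?subr_ge0 //.
have : 0 <= K%:R * t * t by rewrite !mulr_ge0.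
by rewrite -natr1; nra.
Qed.

(** The first bound forces [K] to be at most of order [c ^ (- n)], the second
    one at least of order [d ^ (- n)]; for large [n] there is room in between. *)
Lemma steep_exponents (R : realType) (c d e : R) : 0 < c -> c < d -> c < 1 ->
  0 < e -> exists n K : nat, K%:R * c ^+ n <= e /\ 1 <= e * (K%:R * d ^+ n.+1).
Proof.
move=> c0 cd c1 e0; have d0 : 0 < d by apply: lt_trans cd.
have cd1 : `|c / d| < 1 by rewrite ger0_norm ?ltr_pdivrMr ?mul1r ?divr_ge0 ?ltW.
have c1' : `|c| < 1 by rewrite ger0_norm // ltW.
have H : (e * d)^-1 * (c / d) ^+ n + c ^+ n @[n --> \oo] --> (0 : R).
  rewrite -[X in _ --> X](_ : (e * d)^-1 * 0 + 0 = 0); last by rewrite mulr0 addr0.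
  by apply: cvgD; [apply: cvgMr; exact: cvg_expr|exact: cvg_expr].
have [n _ /(_ n (leqnn n)) /= Hn] : \forall n \near \oo,
    (e * d)^-1 * (c / d) ^+ n + c ^+ n <= e.
  by apply: (cvgr_le (0 : R)).
exists n, (Num.truncn (e * d ^+ n.+1)^-1).+1.
have X0 : 0 <= (e * d ^+ n.+1)^-1.
  by rewrite invr_ge0 mulr_ge0 ?exprn_ge0 ?ltW.
have /andP[X1 X2] := truncn_itv X0; split.
  apply: le_trans Hn; rewrite -natr1 mulrDl mul1r lerD2r.
  apply: le_trans (ler_wpM2r _ X1) _; first by rewrite exprn_ge0 // ltW.
  rewrite exprS expr_div_n !invfM le_eqVlt; apply/orP; left; apply/eqP.
  by ring.
rewrite mulrCA -ler_pdivrMr ?mulr_gt0 ?exprn_gt0 // div1r.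
exact: ltW.
Qed.

(** Take [1 - (1 - y ^ n.+1) ^ K], where [y] maps [-1, 1] into [0, 1].  It is
    at most [K * y ^ n.+1], which is tiny for [y <= c], and at least
    [1 - (1 + K * y ^ n.+1)^-1], which is almost 1 for [y >= c'], as soon as
    [c < c'] and the exponents are well chosen.  The base
    [y = x ^ 2 * ((1 + x) / 2) ^ m] is increasing on the positive axis, provides
    the factor [x ^ 2], and stays below [y a] on the negative axis for large
    [m]. *)
Lemma steep_poly (R : realType) (a b e : R) : 0 < a -> a < b -> a < 1 -> 0 < e ->
  exists q : {poly R}, forall x, -1 <= x <= 1 ->
    [/\ 0 <= x ^+ 2 * q.[x] <= 1,
        x <= a -> x ^+ 2 * q.[x] <= e * x ^+ 2
      & b <= x -> 1 - e <= x ^+ 2 * q.[x]].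
Proof.
move=> a0 ab a1 e0.
have [m Hm] : exists m, 1 <= (1 + a) ^+ m * a ^+ 2.
  (* By Bernoulli, m a ^ 3 > 1 is enough. *)
  exists (Num.truncn (a ^+ 3)^-1).+1; set m := _.+1.
  have : (a ^+ 3)^-1 < m%:R.
    have a30 : 0 <= (a ^+ 3)^-1 by rewrite invr_ge0 exprn_ge0 // ltW.
    by have /andP[] := truncn_itv a30.
  rewrite -[_^-1]div1r ltr_pdivrMr ?exprn_gt0 // => Hm.
  apply: (@le_trans _ _ ((1 + m%:R * a) * a ^+ 2)).
    rewrite mulrDl mul1r -mulrA -exprS.
    by apply: le_trans (ltW Hm) _; rewrite lerDr exprn_ge0 // ltW.
  rewrite ler_wpM2r ?(exprn_ge0 _ (ltW a0)) //.
  elim: m {Hm} => [|m IH]; first by rewrite mul0r addr0 expr0.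
  rewrite exprS; apply: (@le_trans _ _ ((1 + a) * (1 + m%:R * a))).
    have : 0 <= m%:R * a * a by rewrite !mulr_ge0 ?(ltW a0).
    by rewrite -natr1; nra.
  by rewrite ler_wpM2l // addr_ge0 ?(ltW a0).
pose h := (1 + 'X) * (2^-1)%:P : {poly R}.
pose y (x : R) := x ^+ 2 * ((1 + x) / 2) ^+ m.
have hE x : ('X^2 * h ^+ m).[x] = y x.
  by rewrite /h /y !(hornerE, horner_exp).
have half (x : R) : -1 <= x <= 1 -> 0 <= (1 + x) / 2 <= 1 by lra.
have sq1 (x : R) : -1 <= x <= 1 -> 0 <= x ^+ 2 <= 1.
  by move=> xx; rewrite sqr_ge0 expr2 /=; nra.
have y01 x : -1 <= x <= 1 -> 0 <= y x <= 1.
  move=> xx; have /andP[h0 h1] := half x xx; have /andP[s0 s1] := sq1 _ xx.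
  have hm1 : ((1 + x) / 2) ^+ m <= 1 by rewrite exprn_ile1.
  have hm0 := exprn_ge0 m h0.
  by apply/andP; split; [exact: mulr_ge0|exact: mulr_ile1].
have yx x : -1 <= x <= 1 -> y x <= x ^+ 2.
  move=> xx; have /andP[h0 h1] := half x xx; have /andP[s0 s1] := sq1 _ xx.
  by apply: ler_piMr => //; rewrite exprn_ile1.
have mono x z : 0 <= x -> x <= z -> y x <= y z.
  move=> x0 xz; apply: ler_pM; rewrite ?exprn_ge0 //; first lra.
    by rewrite lerXn2r ?nnegrE //; lra.
  by rewrite lerXn2r ?nnegrE //; lra.
have smono x z : 0 < x -> x < z -> y x < y z.
  move=> x0 xz; apply: (@lt_le_trans _ _ (z ^+ 2 * ((1 + x) / 2) ^+ m)).
    rewrite ltr_pM2r ?exprn_gt0 //; last lra.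
    by rewrite ltrXn2r // ?nnegrE; lra.
  by rewrite ler_wpM2l ?sqr_ge0 // lerXn2r ?nnegrE //; lra.
have ya0 : 0 < y a by rewrite /y mulr_gt0 ?exprn_gt0 //; lra.
have ya1 : y a < 1.
  have : y a <= a ^+ 2 by apply: yx; lra.
  by move/le_lt_trans; apply; rewrite expr_lt1 // ltW.
have ya x : -1 <= x <= a -> y x <= y a.
  move=> /andP[x0 xa]; have [x0'|x0'] := leP 0 x; first exact: mono.
  apply: (@le_trans _ _ (1 * (2^-1) ^+ m)).
    apply: ler_pM; rewrite ?sqr_ge0 ?exprn_ge0 //; first lra.
      by have /andP[] : 0 <= x ^+ 2 <= 1 by apply: sq1; lra.
    by rewrite lerXn2r ?nnegrE //; lra.
  rewrite mul1r /y exprMn mulrA; apply: ler_peMl; last by rewrite mulrC.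
  by rewrite exprn_ge0.
have [n [K [HK1 HK2]]] := steep_exponents ya0 (smono _ _ a0 ab) ya1 e0.
(* Y is kept opaque, so that evaluation at x stops at Y. *)
have [Y YE] : exists Y, Y = 'X^2 * h ^+ m by eexists.
have YEx x : Y.[x] = y x by rewrite YE.
exists (h ^+ m * Y ^+ n * \sum_(i < K) (1 - Y ^+ n.+1) ^+ i) => x xx.
have -> : x ^+ 2 * (h ^+ m * Y ^+ n * \sum_(i < K) (1 - Y ^+ n.+1) ^+ i).[x]
   = 1 - (1 - y x ^+ n.+1) ^+ K.
  rewrite !hornerM !horner_exp YEx.
  have := subrX1 (1 - Y ^+ n.+1) K => /(congr1 (fun p : {poly R} => - p.[x])).
  rewrite hornerM !hornerD !hornerN !horner_exp !hornerD !hornerN.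
  rewrite !horner_exp !hornerC YEx opprB => ->.
  have -> : h.[x] = (1 + x) / 2 by rewrite /h !hornerE.
  by rewrite (exprS (y x)); set yn := y x ^+ n; rewrite /y; ring.
have /andP[yx0 yx1] := y01 x xx.
have yn01 : 0 <= y x ^+ n.+1 <= 1 by rewrite exprn_ge0 ?exprn_ile1.
have /andP[yn0 yn1] := yn01.
split.
- have z0 : 0 <= (1 - y x ^+ n.+1) ^+ K by rewrite exprn_ge0 // subr_ge0.
  have : (1 - y x ^+ n.+1) ^+ K <= 1 by rewrite exprn_ile1 // ?subr_ge0 // gerBl.
  by lra.
- move=> xa; have := bernoulli_sub K yn01 => HB.
  apply: (@le_trans _ _ (K%:R * y x ^+ n.+1)); first by lra.
  rewrite exprSr mulrA; apply: ler_pM => //; last exact: yx.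
    by rewrite mulr_ge0 ?exprn_ge0.
  apply: le_trans HK1; rewrite ler_wpM2l // lerXn2r ?nnegrE ?(ltW ya0) //.
  by apply: ya; case/andP: xx => ->.
- move=> bx; have := exp_sub_le_inv K yn01.
  have bnd : 1 <= e * (K%:R * y x ^+ n.+1).
    apply: le_trans HK2 _; rewrite !ler_wpM2l ?(ltW e0) //.
    have yb0 : 0 <= y b by apply: ltW; apply: lt_trans (smono _ _ a0 ab).
    by rewrite lerXn2r ?nnegrE // mono //; lra.
  set z := (1 - _) ^+ K; set t := K%:R * _ in bnd *.
  have z0 : 0 <= z by rewrite exprn_ge0 // subr_ge0.
  rewrite -/t => H; rewrite lerD2l lerN2.
  have : z * (e * (1 + t)) <= e by rewrite mulrCA ger_pMr.
  apply: le_trans; rewrite ler_peMr //; lra.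
Qed.

(** * Convergence of the quantile functions *)

(** In a decreasing sequence the entries greater than [c] come first. *)
Lemma lt_nth_sorted (R : realDomainType) (s : seq R) (c : R) i :
  sorted (fun x y => y <= x) s -> (i < size s)%N ->
  (c < s`_i) = (i < count (fun x => (c < x)%R) s)%N.
Proof.
elim: s i => [//|x s IH] i /= px.
have sle y : y \in s -> y <= x.
  move=> ys; have tr : transitive (fun x y : R => y <= x).
    by move=> y1 y2 y3 h1 h2; exact: le_trans h2 h1.
  by have /allP/(_ y ys) := order_path_min tr px.
have [cx|xc] := ltP c x; first by case: i => [|i] //= si; rewrite IH ?(path_sorted px).
have -> : count (fun x => c < x) s = 0%N.
  apply/eqP; rewrite -leqn0 leqNgt -has_count -all_predC.
  by apply/allP => y /sle yx /=; rewrite -leNgt (le_trans yx).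
move=> si; rewrite ltn0; apply/negbTE; rewrite -leNgt.
by case: i si => [//|i] /= si; apply: le_trans xc; apply/sle/mem_nth.
Qed.

Section TopQuantiles.
Context (R : realType) (s : nat -> seq R) (w : nat -> R) (r : nat -> nat).
Context (alpha : R).
Context (s_sorted : forall n, sorted (fun x y : R => y <= x) (s n)).
Context (s_bound : forall n x, x \in s n -> -1 <= x <= 1).
Context (moments_cvg :
  forall k, cvgn (fun n => w n * \sum_(x <- s n) x ^+ k.+2)).
Context (w_gt0 : forall n, 0 < w n).
Context (r_bounds : forall n, (1 <= r n <= size (s n))%N).
Context (alpha_gt0 : 0 < alpha).
Context (rw_cvg : (r n)%:R * w n @[n --> \oo] --> alpha).
Context (sizew_cvg : (size (s n))%:R * w n @[n --> \oo] --> +oo).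

Let r_gt0 n : 0 < (r n)%:R :> R.
Proof. by rewrite ltr0n; case/andP: (r_bounds n). Qed.

(** The sum over the whole of [s n] is normalized by [r n] only, and yet
    converges: the factor [x ^ 2] makes up for the missing moments 0 and 1. *)
Lemma normalized_poly_sum_cvg (q : {poly R}) :
  cvgn (fun n => (r n)%:R^-1 * \sum_(x <- s n) x ^+ 2 * q.[x]).
Proof.
have -> : (fun n => (r n)%:R^-1 * \sum_(x <- s n) x ^+ 2 * q.[x]) =
    (fun n => ((r n)%:R * w n)^-1 *
      \sum_(i < size q) q`_i * (w n * \sum_(x <- s n) x ^+ i.+2)).
  apply/funext => n; rewrite invfM -mulrA; congr (_ * _).
  rewrite mulr_sumr; under [RHS]eq_bigr do rewrite mulrCA mulKf ?gt_eqF // mulr_sumr.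
  rewrite exchange_big /=; apply: eq_bigr => x _.
  rewrite horner_coef mulr_sumr; apply: eq_bigr => i _.
  by rewrite mulrCA -exprD.
apply: is_cvgM.
  apply: is_cvgV; first by rewrite (cvg_lim _ rw_cvg) // gt_eqF.
  by apply/cvg_ex; exists alpha.
have [m mP] := choice (fun k => (cvg_ex _).1 (moments_cvg (k := k))).
apply/cvg_ex; exists (\sum_(i < size q) q`_i * m i).
by apply: cvg_big => [|i _]; [exact: add_continuous|exact: cvgMr].
Qed.

Let count_above n c : R := (count (fun x => (c < x)%R) (s n))%:R.

Lemma count_aboveE n c :
  count_above n c = \sum_(x <- s n) (c < x)%R%:R.
Proof.
rewrite /count_above -sum1_count natr_sum big_mkcond.
by apply: eq_bigr => x _; case: ifP.
Qed.

Definition top_quantile n (u : R) : R := (s n)`_(Num.truncn (u * (r n)%:R)).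

Lemma truncn_lt_r n (u : R) : 0 <= u < 1 -> (Num.truncn (u * (r n)%:R) < r n)%N.
Proof.
move=> /andP[u0 u1]; rewrite truncn_lt_nat ?mulr_ge0 //.
by rewrite gtr_pMl.
Qed.

Lemma lt_top_quantile n (u c : R) : 0 <= u < 1 ->
  (c < top_quantile n u) = (u * (r n)%:R < count_above n c).
Proof.
move=> u01; have /andP[u0 u1] := u01.
rewrite /top_quantile lt_nth_sorted //; last first.
  by apply: leq_trans (truncn_lt_r n u01) _; case/andP: (r_bounds n).
by rewrite truncn_lt_nat ?mulr_ge0.
Qed.

Lemma top_quantile_bound n (u : R) : 0 <= u < 1 -> -1 <= top_quantile n u <= 1.
Proof.
move=> u01; apply: (s_bound (n := n)); apply: mem_nth.
by apply: leq_trans (truncn_lt_r n u01) _; case/andP: (r_bounds n).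
Qed.

(** The averages of a steep polynomial [p] between [a] and [b] tend to some [l].
    Infinitely often they are at most [u] up to a small error (as [p] is almost
    below the indicator of the numbers above [a]), and infinitely often at least
    [v] up to a small error (as [p] is almost 1 on the numbers above [b]); so
    [v <= l <= u] up to small errors.  Used in both directions, it shows that at
    most one point sees its quantiles cross the gap between [a] and [b]
    infinitely often. *)
Lemma crossing_le (a b u v : R) : 0 < a -> a < b -> a < 1 ->
  0 <= u < 1 -> 0 <= v < 1 ->
  (forall m, exists2 n, (m <= n)%N & top_quantile n u <= a) ->
  (forall m, exists2 n, (m <= n)%N & b < top_quantile n v) ->
  v <= u.
Proof.
move=> a0 ab a1 u01 v01 freq_a freq_b.
have /andP[v0 v1] := v01.
have /cvg_seq_bounded [M0 [_ M0P]] := normalized_poly_sum_cvg (q := 1).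
have [M M_gt0 MP] : exists2 M, 0 < M &
    forall n, (r n)%:R^-1 * \sum_(x <- s n) x ^+ 2 <= M.
  exists (`|M0| + 1); first by rewrite ltr_wpDl.
  move=> n; have := M0P (`|M0| + 1); rewrite (le_lt_trans (ler_norm _)) ?ltrDl //.
  move=> /(_ isT n I) /=; under eq_bigr do rewrite hornerC mulr1.
  exact: le_trans (ler_norm _).
rewrite leNgt; apply/negP => uv.
(* This makes e (v + M) at most half of v - u, so that the bounds
   (1 - e) v <= l <= u + e M contradict each other. *)
pose e := (v - u) / (2 * (M + 1)).
have e0 : 0 < e by rewrite divr_gt0 ?subr_gt0 // mulr_gt0 // addr_gt0.
have [q qP] := steep_poly a0 ab a1 e0.
have /cvg_ex [l lP] := normalized_poly_sum_cvg (q := q).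
have l_le : l <= u + e * M.
  rewrite leNgt; apply/negP => /(cvgr_gt l lP) [m _ mP].
  have [n mn] := freq_a m; rewrite leNgt lt_top_quantile // -leNgt => cnt.
  have := mP n mn; rewrite /= ltNge => /negP; apply.
  apply: (@le_trans _ _ ((r n)%:R^-1 *
     (count_above n a + e * \sum_(x <- s n) x ^+ 2))).
    rewrite ler_wpM2l ?invr_ge0 // count_aboveE mulr_sumr -big_split /=.
    rewrite big_seq [leRHS]big_seq; apply: ler_sum => x /s_bound xx.
    have [/andP[p0 p1] pa _] := qP x xx.
    have [ax|xa] := ltP a x; last by rewrite add0r pa.
    by apply: le_trans p1 _; rewrite lerDl mulr_ge0 ?sqr_ge0 // ltW.
  rewrite mulrDr lerD //; first by rewrite mulrC ler_pdivrMr.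
  by rewrite mulrCA ler_wpM2l // ltW.
have l_ge : (1 - e) * v <= l.
  rewrite leNgt; apply/negP => /(cvgr_lt l lP) [m _ mP].
  have [n mn] := freq_b m; rewrite lt_top_quantile // => cnt.
  have := mP n mn; rewrite /= ltNge => /negP; apply.
  have [e1|e1] := leP 0 (1 - e); last first.
    apply: (@le_trans _ _ 0); first by rewrite mulr_le0_ge0 // ltW.
    rewrite mulr_ge0 ?invr_ge0 // big_seq sumr_ge0 // => x /s_bound xx.
    by have [/andP[]] := qP x xx.
  apply: (@le_trans _ _ ((r n)%:R^-1 * ((1 - e) * count_above n b))).
    rewrite mulrCA ler_wpM2l // mulrC ler_pdivlMr //; exact: ltW.
  rewrite ler_wpM2l ?invr_ge0 // count_aboveE mulr_sumr.
  rewrite big_seq [leRHS]big_seq; apply: ler_sum => x /s_bound xx.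
  have [/andP[p0 p1] _ pb] := qP x xx.
  have [bx|xb] := ltP b x; last by rewrite mulr0.
  by rewrite mulr1 pb // ltW.
have : (1 - e) * v <= u + e * M by apply: le_trans l_le.
have : e * v <= e * 1 by rewrite ler_wpM2l // ltW.
have : e * (2 * (M + 1)) = v - u by rewrite mulfVK // gt_eqF // mulr_gt0 // addr_gt0.
have := mulr_gt0 e0 M_gt0.
lra.
Qed.

(** By Chebyshev, at most [M / (w n * e ^ 2)] entries of [s n] are [<= - e];
    after multiplication by [w n], what remains tends to infinity, while
    [r n * w n] tends to [alpha]. *)
Lemma top_quantile_liminf (u e : R) : 0 <= u < 1 -> 0 < e ->
  \forall n \near \oo, - e < top_quantile n u.
Proof.
move=> u01 e0; have /andP[u0 u1] := u01.
have /cvg_seq_bounded [M0 [_ M0P]] := moments_cvg (k := 0).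
have [M MP] : exists M, forall n, w n * \sum_(x <- s n) x ^+ 2 <= M.
  exists (`|M0| + 1) => n; have := M0P (`|M0| + 1).
  rewrite (le_lt_trans (ler_norm _)) ?ltrDl // => /(_ isT n I) /=.
  exact: le_trans (ler_norm _).
have rw_lt : \forall n \near \oo, (r n)%:R * w n < alpha + 1.
  by apply: (cvgr_lt alpha) => //; rewrite ltrDl.
have size_gt : \forall n \near \oo, (alpha + 1) + M / e ^+ 2 < (size (s n))%:R * w n.
  by move/cvgryPgt : sizew_cvg; apply.
near=> n.
rewrite lt_top_quantile //; apply: (@lt_le_trans _ _ (r n)%:R).
  by rewrite gtr_pMl.
rewrite -(ler_pM2r (w_gt0 n)); apply: (@le_trans _ _ (alpha + 1)).
  by apply/ltW; near: n.
have : (size (s n))%:R * w n - M / e ^+ 2 <= count_above n (- e) * w n.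
  rewrite lerBlDr -lerBlDl -mulrBl.
  have e20 : 0 < e ^+ 2 by rewrite exprn_gt0.
  rewrite ler_pdivlMr //; apply: le_trans (MP n).
  rewrite mulrAC mulrC ler_wpM2l ?(ltW (w_gt0 n)) //.
  rewrite count_aboveE -sum1_size natr_sum -sumrB mulr_suml.
  apply: ler_sum => x _; have [ex|xe] := ltP.
    by rewrite subrr mul0r sqr_ge0.
  by rewrite subr0 mul1r; nra.
have : alpha + 1 + M / e ^+ 2 < (size (s n))%:R * w n by near: n.
by lra.
Unshelve. all: by end_near.
Qed.

(** For rational [a < b] let [U (a, b)] be the only point, if any, whose quantiles
    are infinitely often [<= a] and infinitely often [> b].  A point outside the
    countable range of [U] cannot oscillate around any such gap above 0, and
    [top_quantile_liminf] takes care of the negative values. *)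
Lemma top_quantile_cvg : exists2 C : set R, countable C &
  forall u : R, 0 <= u < 1 -> ~ C u ->
    exists2 l : R, 0 <= l <= 1 & top_quantile n u @[n --> \oo] --> l.
Proof.
have exU : forall ab : rat * rat, exists v : R,
    forall u : R, 0 < ratr ab.1 :> R -> ratr ab.1 < ratr ab.2 :> R ->
    ratr ab.1 < 1 :> R -> 0 <= u < 1 ->
  (forall m, exists2 n, (m <= n)%N & top_quantile n u <= ratr ab.1) ->
  (forall m, exists2 n, (m <= n)%N & ratr ab.2 < top_quantile n u) -> u = v.
  move=> [a b] /=.
  have [[v [a0 ab a1 v01 [va vb]]]|H] := pselect (exists v : R,
    [/\ 0 < ratr a :> R, ratr a < ratr b :> R,
    ratr a < 1 :> R, 0 <= v < 1 &
  (forall m, exists2 n, (m <= n)%N & top_quantile n v <= ratr a) /\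
  (forall m, exists2 n, (m <= n)%N & ratr b < top_quantile n v)]).
    exists v => u _ _ _ u01 ua ub; apply/eqP; rewrite eq_le.
    rewrite (crossing_le a0 ab a1 v01 u01 va ub).
    by rewrite (crossing_le a0 ab a1 u01 v01 ua vb).
  by exists 0 => u *; exfalso; apply: H; exists u.
have [U UP] := choice exU.
exists (range U).
  by apply: sub_countable (card_image_le _ _) _; exact: countableP.
move=> u u01 NCu.
(* The infimum of E is the upper limit of the quantiles at u. *)
pose E := [set c : R | \forall n \near \oo, top_quantile n u <= c].
have E1 : E 1 by apply: nearW => n; case/andP: (top_quantile_bound n u01).
have Elb c : E c -> 0 <= c.
  move=> Ec; apply/ler_addgt0Pr => e e0.
  have := filterI Ec (top_quantile_liminf u01 e0).
  move=> [m _ /(_ m (leqnn m))] /= [h1 h2]; lra.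
have infE : has_inf E by split; [exists 1|exists 0 => c /Elb].
pose l := inf E.
have l0 : 0 <= l by apply: lb_le_inf; [exists 1|exact: Elb].
have l1 : l <= 1 by apply: ge_inf E1; case: infE.
exists l; first by rewrite l0.
apply/cvgrPdist_lt => e e0.
have upper : \forall n \near \oo, top_quantile n u < l + e.
  have [c Ec cl] := inf_adherent e0 infE.
  by apply: filterS Ec => n /le_lt_trans; apply.
suff lower : \forall n \near \oo, l - e < top_quantile n u.
  by near=> n; rewrite ltr_distlC; apply/andP; split; near: n.
have [l_le0|l_gt0] := leP l 0.
  by apply: filterS (top_quantile_liminf u01 e0) => n; apply: le_lt_trans; lra.
apply: contrapT => Nlower; apply: NCu.
have ml : Num.max 0 (l - e) < l by rewrite gt_max l_gt0 gtrBl.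
have [b] := rat_in_itvoo ml; rewrite in_itv /= => /andP[mb bl].
have [a] := rat_in_itvoo mb; rewrite in_itv /= gt_max => /andP[/andP[a0 la] ab].
exists (a, b) => //; apply/esym/UP => //=; first by lra.
  move=> m; apply: contrapT => H; apply: Nlower; exists m => // n /= mn.
  apply: (lt_trans la); rewrite ltNge; apply/negP => qa.
  by apply: H; exists n.
move=> m; apply: contrapT => H; move: bl; rewrite ltNge => /negP; apply.
apply: ge_inf; first by case: infE.
exists m => // n /= mn; rewrite leNgt; apply/negP => qb.
by apply: H; exists n.
Unshelve. all: by end_near.
Qed.

End TopQuantiles.

(** * Integrals for uniform measures *)

Lemma ge0_integral_uniform_measure (R : realType) (s : seq R)
    (g : R -> \bar R) :
  measurable_fun [set: R] g -> (forall x, 0 <= g x)%E ->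
  (\int[uniform_measure s]_x g x = (size s)%:R^-1%:E * \sum_(x <- s) g x)%E.
Proof.
move=> mg g0; rewrite /uniform_measure ge0_integral_mscale //=.
rewrite ge0_integral_measure_sum //; congr (_ * _)%E.
rewrite (big_nth 0) big_mkord; apply: eq_bigr => i _.
by rewrite integral_dirac // diracT mul1e.
Qed.

Lemma integral_uniform_measure (R : realType) (s : seq R) (f : R -> R) :
  continuous f ->
  (\int[uniform_measure s]_x (f x)%:E)%E =
  ((size s)%:R^-1 * \sum_(x <- s) f x)%:E.
Proof.
move=> cf; have mf : measurable_fun [set: R] f.
  exact: continuous_measurable_fun.
rewrite integralE -/(EFin \o f) funerpos funerneg.
rewrite !ge0_integral_uniform_measure.
- rewrite !sumEFin -!EFinM -EFinB -mulrBr -sumrB.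
  congr (_ * _)%:E; apply: eq_bigr => x _.
  by rewrite -[in RHS](funrposBneg f).
- exact/measurable_EFinP/measurable_funrneg.
- by move=> x; rewrite lee_fin funrneg_ge0.
- exact/measurable_EFinP/measurable_funrpos.
- by move=> x; rewrite lee_fin funrpos_ge0.
Qed.

Section UnitInterval.
Context (R : realType).
Implicit Types (u : R) (m i : nat).

Definition slice m i : set (measurableTypeR R) := `[i%:R / m%:R, i.+1%:R / m%:R[.

Lemma measurable_slice m i : measurable (slice m i).
Proof. exact: measurable_itv. Qed.

(** For [u] in the unit interval, [Num.truncn (u * m)] is the index of the slice
    that contains [u]. *)
Lemma step_sumE (g : nat -> R) m u : 0 <= u < 1 -> (0 < m)%N ->
  \sum_(i < m) g i * \1_(slice m i) u = g (Num.truncn (u * m%:R)).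
Proof.
move=> /andP[u0 u1] m0.
have mR : 0 < m%:R :> R by rewrite ltr0n.
have um0 : 0 <= u * m%:R by rewrite mulr_ge0.
have km : (Num.truncn (u * m%:R) < m)%N by rewrite truncn_lt_nat // gtr_pMl.
have sliceE i : (u \in slice m i) = (i == Num.truncn (u * m%:R)).
  rewrite /slice mem_setE in_itv /= ler_pdivrMr // ltr_pdivlMr //.
  by rewrite eq_sym truncn_eq.
rewrite (bigD1 (Ordinal km)) //= indicE sliceE eqxx mulr1 big1 ?addr0 // => i ik.
by rewrite indicE sliceE -val_eqE /= in ik *; rewrite (negbTE ik) mulr0.
Qed.

Let P : probability (measurableTypeR R) R := uniform_prob (@ltr01 R).

Lemma uniform_prob01E (A : set (measurableTypeR R)) : measurable A ->
  P A = lebesgue_measure (A `&` `[0, 1]).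
Proof.
move=> mA; rewrite /P /= /uniform_prob integral_uniform_pdf.
rewrite (eq_integral (cst 1%E)); last first.
  move=> x; rewrite inE /= in_itv /= /uniform_pdf => -[_ ->].
  by rewrite subr0 invr1.
by rewrite integral_cst ?mul1e //; exact: measurableI.
Qed.

Lemma uniform_prob_slice m i : (i < m)%N -> P (slice m i) = (m%:R^-1)%:E.
Proof.
move=> im; have m0 : 0 < m%:R :> R by rewrite ltr0n (leq_ltn_trans _ im).
have sub : slice m i `<=` `[0, 1].
  move=> x; rewrite /slice /= !in_itv /= => /andP[ix xi].
  rewrite (le_trans _ ix) ?divr_ge0 //= (le_trans (ltW xi)) //.
  by rewrite ler_pdivrMr // mul1r ler_nat.
rewrite uniform_prob01E; last exact: measurable_slice.
rewrite (setIidl sub).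
rewrite /slice lebesgue_measure_itv /= lte_fin ltr_pM2r ?invr_gt0 // ltr_nat ltnSn.
by rewrite -EFinB -mulrBl -natrB // subSnn mul1r.
Qed.

Lemma integral_step (g : nat -> R) m : (0 < m)%N ->
  (\int[P]_u (\sum_(i < m) g i * \1_(slice m i) u)%:E)%E =
  (m%:R^-1 * \sum_(i < m) g i)%:E.
Proof.
move=> m0; under eq_integral do rewrite -sumEFin.
have intI i : P.-integrable setT (fun x => (\1_(slice m i) x)%:E).
  exact: integrable_indic (measurable_slice m i).
rewrite integral_sum //; last first.
  by move=> i; under eq_fun do rewrite EFinM; exact: integrableZl.
rewrite mulr_sumr -sumEFin; apply: eq_bigr => i _.
under eq_integral do rewrite EFinM.
rewrite integralZl // integral_indic ?setIT //; last exact: measurable_slice.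
by rewrite [X in (_ * X)%E](uniform_prob_slice (ltn_ord i)) -EFinM mulrC.
Qed.

Lemma uniform_prob_countableC (C : set R) : countable C ->
  P (~` (`[0, 1[ `\` C)) = 0%E.
Proof.
move=> cC; have mD : measurable (`[0, 1[ `\` C : set (measurableTypeR R)).
  by apply: measurableD => //; exact: countable_measurable.
have mDC := measurableC mD.
rewrite uniform_prob01E //; apply: measure_negligible.
  by apply: measurableI => //; exact: measurable_itv.
refine (negligibleS (A := (C `|` [set 1] : set (measurableTypeR R))) _ _).
  move=> x [/= /not_andP nD]; rewrite in_itv /= => /andP[x0 x1].
  have [|x1'] := eqVneq x 1; first by right.
  left; case: nD => [|/contrapT //]; rewrite in_itv /= x0 /=.
  by rewrite lt_neqAle x1' x1.
have mC : measurable (C : set (measurableTypeR R)).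
  exact: countable_measurable.
apply: negligibleU; first by apply/negligibleP => //; exact: (countable_lebesgue_measure0 cC).
apply/negligibleP; [exact: measurable_set1|exact: lebesgue_measure_set1].
Qed.

End UnitInterval.

(** * Weak limits of uniform measures *)

(** The uniform measures on the entries of [t n] converge to the law of [q]
    under the uniform probability on the unit interval. *)
Definition averages_to (R : realType) (t : nat -> seq R) (q : R -> R) : Prop :=
  measurable_fun [set: R] q /\
  forall f : R -> R, continuous f -> bounded_fun f ->
    ((size (t n))%:R^-1 * \sum_(x <- t n) f x)%:E @[n --> \oo] -->
      (\int[uniform_prob (@ltr01 R)]_u (f (q u))%:E)%E.

(** The quantile functions are step functions, with integrals equal to the
    averages; they converge off a null set, and dominated convergence applies
    to their images under a bounded continuous function. *)
Lemma top_average_cvg (R : realType) (s : nat -> seq R) (w : nat -> R)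
    (r : nat -> nat) (alpha : R) :
  (forall n, sorted (fun x y : R => y <= x) (s n)) ->
  (forall n x, x \in s n -> -1 <= x <= 1) ->
  (forall k, cvgn (fun n => w n * \sum_(x <- s n) x ^+ k.+2)) ->
  (forall n, 0 < w n) ->
  (forall n, (1 <= r n <= size (s n))%N) ->
  0 < alpha ->
  (r n)%:R * w n @[n --> \oo] --> alpha ->
  (size (s n))%:R * w n @[n --> \oo] --> +oo ->
  exists2 q : R -> R, (forall u, 0 <= q u <= 1) &
    averages_to (fun n => take (r n) (s n)) q.
Proof.
move=> s_sorted s_bound mom w0 r_bounds alpha0 rw sw.
have r0 n : (0 < r n)%N by case/andP: (r_bounds n).
have [C cC cvgC] :=
  top_quantile_cvg s_sorted s_bound mom w0 r_bounds alpha0 rw sw.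
pose D : set R := `[0, 1[ `\` C.
have D01 u : D u -> 0 <= u < 1 by case; rewrite /= in_itv.
have mD : measurable (D : set (measurableTypeR R)).
  by apply: measurableD => //; exact: countable_measurable.
have PD := uniform_prob_countableC cC.
have exq u : exists l : R, 0 <= l <= 1 /\
    (if u \in D then top_quantile s r n u @[n --> \oo] --> l else l = 0).
  have [|_] := boolP (u \in D); last by exists 0; rewrite lexx ler01.
  rewrite inE => Du; have [l l01 lP] := cvgC u (D01 u Du) Du.2.
  by exists l.
have [q qP] := choice exq.
(* On the unit interval, F f n is the image under f of the quantile function. *)
pose F (f : R -> R) n (u : R) :=
  \sum_(i < r n) f (s n)`_i * \1_(slice (r n) i) u.
have FE f n u : 0 <= u < 1 -> F f n u = f (top_quantile s r n u).
  by move=> u01; rewrite /F (step_sumE (fun i => f (s n)`_i)).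
have mF f n : measurable_fun [set: R] (F f n).
  apply: measurable_sum => i; apply: measurable_funM => //.
  exact: measurable_indic (measurable_slice _ _).
have mq : measurable_fun [set: R] q.
  apply: (@measurable_fun_cvg _ _ _ _ (fun n u => F id n u * \1_D u)).
    by move=> n; apply: measurable_funM; [exact: mF|exact: measurable_indic].
  move=> u _; have [_] := qP u; rewrite indicE.
  case: ifPn => [|_ ->].
    rewrite inE => Du; apply: cvg_trans; apply: near_eq_cvg.
    by apply: nearW => n; rewrite mulr1 FE //; exact: D01.
  by under eq_fun do rewrite mulr0; exact: cvg_cst.
exists q => [u|]; first by have [] := qP u.
split=> // f cf bf.
have [B0 [_ BP]] := bf.
pose B := `|B0| + 1.
have fB x : `|f x| <= B.
  by apply: (BP B) => //; rewrite (le_lt_trans (ler_norm _)) // ltrDl.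
have mf : measurable_fun [set: R] f by exact: continuous_measurable_fun.
have aeD (Q : R -> Prop) : (forall u, D u -> Q u) ->
    {ae uniform_prob (@ltr01 R), forall u, Q u}.
  move=> DQ; exists (~` D); split; [exact: measurableC|exact: PD|].
  by move=> u /= nQ Du; apply/nQ/DQ.
have conv : {ae uniform_prob (@ltr01 R), forall u, setT u ->
    (fun n => (F f n u)%:E) @ \oo --> (f (q u))%:E}.
  apply: aeD => u Du _; apply: cvg_EFin; first exact: nearW.
  rewrite (_ : fine \o _ = f \o (fun n => top_quantile s r n u)); last first.
    by apply/funext => n /=; rewrite FE //; exact: D01.
  have [_] := qP u; rewrite (mem_set Du) => qu.
  by apply: cvg_comp qu _; exact: cf.
have dom : {ae uniform_prob (@ltr01 R), forall u n, setT u ->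
    (`|(F f n u)%:E| <= (cst B%:E) u)%E}.
  by apply: aeD => u Du n _; rewrite /= lee_fin FE //; exact: D01.
have mFE n : measurable_fun [set: R] (fun u => (F f n u)%:E).
  by apply/measurable_EFinP; exact: mF.
have mfq : measurable_fun [set: R] (fun u => (f (q u))%:E).
  by apply/measurable_EFinP; exact: measurableT_comp.
have intB : (uniform_prob (@ltr01 R)).-integrable setT (cst B%:E).
  exact: finite_measure_integrable_cst.
have [_ _] := @dominated_convergence _ (measurableTypeR R) R
  (uniform_prob (@ltr01 R)) setT measurableT _ _ _ mFE mfq conv intB dom.
rewrite (_ : [sequence _]_n = fun n =>
  ((size (take (r n) (s n)))%:R^-1 * \sum_(x <- take (r n) (s n)) f x)%:E) //.
apply/funext => n; apply: etrans (integral_step (fun i => f (s n)`_i) (r0 n)) _.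
case/andP: (r_bounds n) => _ rs; rewrite size_takel //; congr (_ * _)%:E.
rewrite (big_nth 0) size_takel // big_mkord.
by apply: eq_bigr => i _; rewrite nth_take.
Qed.

Lemma averages_to_opp (R : realType) (t : nat -> seq R) (q : R -> R) :
  averages_to t q -> averages_to (fun n => map -%R (t n)) (fun u => - q u).
Proof.
move=> [mq avg]; split=> [|f cf bf]; first exact: measurable_funN.
have cfN : continuous (f \o -%R).
  by move=> x; apply: continuous_comp; [exact: oppr_continuous|exact: cf].
have bfN : bounded_fun (f \o -%R).
  by have [M [Mr MP]] := bf; exists M; split => // x /MP fx u _; exact: fx.
apply: cvg_trans (avg _ cfN bfN); apply: near_eq_cvg.
by apply: nearW => n /=; rewrite size_map big_map.
Qed.

Lemma weak_cvg_of_averages (R : realType) (t : nat -> seq R) (q : R -> R)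
    (a b : R) :
  averages_to t q -> (forall u, a <= q u <= b) ->
  exists2 sigma : probability (measurableTypeR R) R,
    weak_cvg (fun n => uniform_measure (t n)) sigma &
    supported_on sigma `[a, b].
Proof.
move=> [mq avg] qab.
pose P : probability (measurableTypeR R) R := uniform_prob (@ltr01 R).
pose Q : {mfun measurableTypeR R >-> measurableTypeR R} :=
  MeasurableFun.Pack (MeasurableFun.Class
    (isMeasurableFun.Build _ _ (measurableTypeR R) (measurableTypeR R) q mq)).
exists (distribution P Q) => [f cf bf|]; last first.
  rewrite /supported_on /= /distribution /pushforward.
  rewrite (_ : _ @^-1` _ = set0) ?measure0 //.
  by apply/seteqP; split=> // u /=; apply; rewrite in_itv /=.
under eq_fun do rewrite integral_uniform_measure //.
have mf : measurable_fun [set: R] f by exact: continuous_measurable_fun.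
rewrite integral_distribution; first exact: avg.
  exact/measurable_EFinP.
apply: (@measurable_bounded_integrable _ _ _ P (f \o q)) => //.
- by apply: le_lt_trans (probability_le1 P measurableT) _; rewrite ltry.
- exact: measurableT_comp.
- have [M [Mr MP]] := bf; exists M; split => // x /MP fx u _.
  exact: fx.
Qed.

(** * Top and bottom of the spectra of a convergent sequence *)

Lemma hom_density_cycle (R : realType) (G : sgraph) (d : R) k : d != 0 ->
  hom_density (cycle_graph k) G d =
  d / (num_nodes G)%:R *
    \sum_(x <- spectrum (adjacency R G)) (x / d) ^+ k.+2.
Proof.
move=> d0; rewrite /hom_density num_homs_cycle num_comps_cycle num_nodes_cycle.
have [_ <-] := spectrum_symmetric (adjacency_sym R G).
rewrite expr1 subn1 /= invfM mulr_suml mulr_sumr; apply: eq_bigr => x _.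
rewrite expr_div_n (exprS d k.+1) [(d * _)^-1]invfM -[LHS]mul1r -(divff d0).
by ring.
Qed.

Theorem theorem2p3 (R : realType) (G : nat -> sgraph) (d : nat -> R)
    (r : nat -> nat) (alpha : R)
    (admG : forall n, admissible (G n) (d n))
    (cvgG : convergent G d)
    (d_infty : d @ \oo --> +oo)
    (r_bounds : forall n, (1 <= r n <= num_nodes (G n))%N)
    (alpha_gt0 : 0 < alpha)
    (r_cvg : (r n)%:R * d n / (num_nodes (G n))%:R @[n --> \oo] --> alpha) :
  exists sigma sigma' : probability (measurableTypeR R) R,
    [/\ weak_cvg (fun n => uniform_measure
          [seq lambda / d n | lambda <- largest_eigenvalues R (G n) (r n)]) sigma,
        supported_on sigma `[0, 1],
        weak_cvg (fun n => uniform_measure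
          [seq lambda / d n | lambda <- smallest_eigenvalues R (G n) (r n)]) sigma'
      & supported_on sigma' `[-1, 0]].
Proof.
have d_gt0 n : 0 < d n by have [d1 _] := admG n; exact: lt_le_trans d1.
have N_gt0 n : 0 < (num_nodes (G n))%:R :> R.
  by rewrite ltr0n; have /andP[r1] := r_bounds n; exact: leq_trans.
pose w n := d n / (num_nodes (G n))%:R.
have w_gt0 n : 0 < w n by rewrite divr_gt0.
pose spec n := spectrum (adjacency R (G n)).
have size_spec n : size (spec n) = num_nodes (G n).
  by have [] := spectrum_symmetric (adjacency_sym R (G n)).
have r_size n : (r n <= size (spec n))%N.
  by rewrite size_spec; case/andP: (r_bounds n).
have spec_bound n x : x \in spec n -> -1 <= x / d n <= 1.
  move=> /(spectrum_adjacency_le (admG n).2); rewrite ler_norml => /andP[x1 x2].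
  by rewrite ler_pdivlMr // mulN1r x1 ler_pdivrMr // mul1r.
have mom k : cvgn (fun n => w n * \sum_(x <- spec n) (x / d n) ^+ k.+2).
  suff -> : (fun n => w n * \sum_(x <- spec n) (x / d n) ^+ k.+2) =
    (fun n => hom_density (cycle_graph k) (G n) (d n)) by exact: cvgG.
  by apply/funext => n; rewrite hom_density_cycle // gt_eqF.
have rw_cvg : (r n)%:R * w n @[n --> \oo] --> alpha.
  by under eq_fun do rewrite mulrA.
(* Both ends of the spectrum at once: c is the sign that puts the relevant
   eigenvalues on top. *)
have top_cvg (c : bool) (s : nat -> seq R) :
    (forall n, sorted (fun x y : R => y <= x) (s n)) ->
    (forall n, perm_eq (s n) [seq (-1) ^+ c * (x / d n) | x <- spec n]) ->
    exists2 q : R -> R, (forall u, 0 <= q u <= 1) &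
      averages_to (fun n => take (r n) (s n)) q.
  move=> s_sorted s_perm.
  have size_s n : size (s n) = num_nodes (G n).
    by rewrite (perm_size (s_perm n)) size_map size_spec.
  apply: (top_average_cvg s_sorted _ _ w_gt0 _ alpha_gt0 rw_cvg).
  - move=> n y; rewrite (perm_mem (s_perm n)) => /mapP[x /spec_bound xx ->].
    by case: c {s_perm}; rewrite ?expr1 ?expr0 ?mulN1r ?mul1r // lerN2 lerNl andbC.
  - move=> k; suff -> : (fun n => w n * \sum_(x <- s n) x ^+ k.+2) = (fun n =>
        ((-1) ^+ c) ^+ k.+2 * (w n * \sum_(x <- spec n) (x / d n) ^+ k.+2)).
      exact: is_cvgMr (mom k).
    apply/funext => n; rewrite (perm_big _ (s_perm n)) big_map [RHS]mulrCA.
    congr (_ * _); rewrite mulr_sumr; apply: eq_bigr => x _.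
    exact: exprMn.
  - by move=> n; rewrite size_s -size_spec r_size andbT; case/andP: (r_bounds n).
  - have -> : (fun n => (size (s n))%:R * w n) = d => //.
    by apply/funext => n; rewrite size_s mulrC divfK // gt_eqF.
have [||q q01 avg] := top_cvg false
  (fun n => [seq x / d n | x <- sort (fun x y : R => y <= x) (spec n)]).
- move=> n; apply: (homo_sorted (e := fun x y : R => y <= x)) => [x y|].
    by rewrite ler_pM2r ?invr_gt0.
  by apply: sort_sorted => x y; exact: le_total.
- move=> n; rewrite (eq_map (fun x => mul1r (x / d n))).
  by rewrite perm_map // perm_sort.
have [||q' q'01 /averages_to_opp avg'] := top_cvg true
  (fun n => [seq - (x / d n) | x <- sort (fun x y : R => x <= y) (spec n)]).
- move=> n; apply: (homo_sorted (e := fun x y : R => x <= y)) => [x y|].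
    by rewrite lerN2 ler_pM2r ?invr_gt0.
  by apply: sort_sorted => x y; exact: le_total.
- move=> n; rewrite (eq_map (fun x => mulN1r (x / d n))).
  by rewrite perm_map // perm_sort.
have [sigma wsigma ssigma] := weak_cvg_of_averages avg q01.
have Nq'01 u : -1 <= - q' u <= 0 by rewrite lerN2 oppr_le0 andbC q'01.
have [sigma' wsigma' ssigma'] := weak_cvg_of_averages avg' Nq'01.
exists sigma, sigma'; split=> //.
- move: wsigma; congr weak_cvg; apply/funext => n; congr uniform_measure.
  by rewrite -map_take.
- move: wsigma'; congr weak_cvg; apply/funext => n; congr uniform_measure.
  rewrite -map_take -map_comp; apply: eq_map => x /=.
  by rewrite opprK.
Qed.
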